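(* Let $\mathbb F$ and $\mathbb H$ be bivariant theories on a category $\mathcal C$ with final object $pt$, and let $c_*:F(X)=\mathbb F(X\to pt)\to\mathbb H(X\to pt)=H_*(X)$ be a natural transformation of the associated covariant theories which commutes with exterior products and maps the unit $1_{pt}\in F(pt)$ to the unit $1_{pt}\in H_*(pt)$. Let $\widetilde{\mathbb F}$ and $\widetilde{\mathbb H}$ be the bivariant theories associated to $c_*$ (defined in the context). Then there exists a unique Grothendieck transformation $$\widetilde\gamma:\widetilde{\mathbb F}\to\widetilde{\mathbb H}$$ whose associated covariant transformation is $c_*:F\to\mathrm{Im}(c_* )$, where $\mathrm{Im}(c_* )(X):=\mathrm{Image}\bigl(c_*:F(X)\to H_*(X)\bigr)$.
   Context: $\mathcal C$ is a category with a final object $pt$ and fiber products, with a class of ''confined'' morphisms (containing identities, closed under composition and under base change in independent squares) and a class of ''independent'' squares, which are Cartesian, contain the identity squares and are closed under horizontal and vertical composition; the product squares over $pt$ are independent, so that exterior products are defined. A bivariant theory $\mathbb B$ on $\mathcal C$ assigns to each morphism $f:X\to Y$ a (graded) abelian group $\mathbb B(X\xrightarrow{f}Y)$ with three operations (homomorphisms): (1) products $\bullet:\mathbb B(X\xrightarrow{f}Y)\otimes\mathbb B(Y\xrightarrow{g}Z)\to\mathbb B(X\xrightarrow{gf}Z)$; (2) pushforwards $f_*:\mathbb B(X\xrightarrow{gf}Z)\to\mathbb B(Y\xrightarrow{g}Z)$ for $f:X\to Y$ confined; (3) pullbacks $g^*:\mathbb B(X\xrightarrow{f}Y)\to\mathbb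 B(X'\xrightarrow{f'}Y')$ for each independent square with top $g':X'\to X$, bottom $g:Y'\to Y$, left side $f'$ and right side $f$. They satisfy the seven Fulton--MacPherson axioms: product is associative; pushforward is functorial; pullback is functorial; $f_*(\alpha\bullet\beta)=f_*\alpha\bullet\beta$; for independent squares stacked vertically, with $h:Z'\to Z$ at the bottom and $h':Y'\to Y$ in the middle, $h^*(\alpha\bullet\beta)=h'^*\alpha\bullet h^*\beta$; in the same situation with $f:X\to Y$ confined, with base change $f':X'\to Y'$, $h^*(f_*\alpha)=f'_*(h^*\alpha)$; and the projection formula $g'_*(g^*\alpha\bullet\beta)=\alpha\bullet g_*\beta$ for an independent square with $g:Y'\to Y$ confined, $\alpha\in\mathbb B(X\xrightarrow{f}Y)$, $\beta\in\mathbb B(Y'\xrightarrow{hg}Z)$, where $h:Y\to Z$. A Grothendieck transformation $\gamma:\mathbb B\to\mathbb B'$ is a collection of homomorphisms $\gamma_f:\mathbb B(X\xrightarrow{f}Y)\to\mathbb B'(X\xrightarrow{f}Y)$, one for each morphism $f$, preserving the three operations. Its associated covariant transformation is its restriction to morphisms $X\to pt$. $B_*(X):=\mathbb B(X\to pt)$ is covariant for confined maps. The exterior product of $\alpha\in\mathbb B(X\to pt)$ and $\beta\in\mathbb B(Y'\to pt)$ is $\alpha\times\beta:=g^*\alpha\bullet\beta\in\mathbb B(X\times Y'\to pt)$, where $g:Y'\to pt$. Naturality of $c_*$ means that it is a collection of homomorphisms commuting with pushforward by confined maps; commuting with exterior products means $c_*(\alpha\times\beta)=c_*(\alpha)\times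 c_*(\beta)$. Definition of $\widetilde{\mathbb F}$: $\widetilde{\mathbb F}(X\xrightarrow{f}Y)$ is the set of all $\alpha\in\mathbb F(X\xrightarrow{f}Y)$ for which there exists $B_\alpha\in\mathbb H(X\xrightarrow{f}Y)$ such that for every independent square with bottom map $g:Y'\to Y$ and right side $f$, and every $\beta'\in F(Y')$, $c_*(g^*\alpha\bullet\beta')=g^*B_\alpha\bullet c_*(\beta')$. Any such $B_\alpha$ is called a pseudo-bivariant class of $\alpha$. $\widetilde{\mathbb F}$ is a bivariant theory with the operations of $\mathbb F$, and $\widetilde{\mathbb F}(X\to pt)=F(X)$. Definition of $\widetilde{\mathbb H}$: $\mathbb{PH}(X\xrightarrow{f}Y)$ is the set of all $B\in\mathbb H(X\xrightarrow{f}Y)$ that are a pseudo-bivariant class of some $\alpha\in\widetilde{\mathbb F}(X\xrightarrow{f}Y)$, and $\widetilde{\mathbb H}(X\xrightarrow{f}Y):=\mathbb{PH}(X\xrightarrow{f}Y)/\!\sim$, where $B\sim B'$ if and only if $g^*B\bullet c_*(\beta')=g^*B'\bullet c_*(\beta')$ for all independent squares with bottom map $g:Y'\to Y$ and right side $f$, and all $\beta'\in F(Y')$. $\widetilde{\mathbb H}$ is a bivariant theory with the operations induced from $\mathbb H$ on equivalence classes. On $\mathbb{PH}(X\to pt)$ the relation $\sim$ is the identity relation, and $\widetilde{\mathbb H}(X\to pt)=\mathrm{Image}(c_*:F(X)\to H_*(X))$.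
   Formalization: Added hypothesis, without which F̃ need not be closed under products: every independent square over a composite gf splits into two stacked independent squares, and every independent square over g extends upwards along any confined f. Both hold if all Cartesian squares are independent. *)

(* Defs.v *)
From HB Require Import structures.
From mathcomp Require Import all_boot all_algebra.
From mathcomp Require Import boolp.

Set Implicit Arguments.
Unset Strict Implicit.
Unset Printing Implicit Defensive.

Import GRing.Theory.
Local Open Scope ring_scope.
Local Open Scope quotient_scope.

Record category := Category {
  ob :> Type;
  mor : ob -> ob -> Type;
  idm : forall X, mor X X;
  mcomp : forall X Y Z, mor Y Z -> mor X Y -> mor X Z;
  compA : forall X Y Z W (h : mor Z W) (g : mor Y Z) (f : mor X Y),
    mcomp h (mcomp g f) = mcomp (mcomp h g) f;
  comp1m : forall X Y (f : mor X Y), mcomp (idm Y) f = f;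
  compm1 : forall X Y (f : mor X Y), mcomp f (idm X) = f
}.

Arguments idm {c} X.
Arguments mcomp {c X Y Z} g f.

Declare Scope cat_scope.
Delimit Scope cat_scope with cat.
Notation "g '∘' f" := (mcomp g f) (at level 40, left associativity) : cat_scope.
Local Open Scope cat_scope.

(* In every predicate on squares the arguments are listed in the order
   top, left, right, bottom:

            g'
       X' -----> X
       |         |
    f' |         | f
       v         v
       Y' -----> Y
            g                                                            *)
Definition cartesian (C : category) (X Y X' Y' : C)
    (g' : mor X' X) (f' : mor X' Y') (f : mor X Y) (g : mor Y' Y) : Prop :=
  f ∘ g' = g ∘ f' /\
  forall (W : C) (a : mor W X) (b : mor W Y'), f ∘ a = g ∘ b ->
    exists! u : mor W X', g' ∘ u = a /\ f' ∘ u = b.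

Record bivCategory := BivCategory {
  bcat :> category;
  pt : bcat;
  to_pt : forall X : bcat, mor X pt;
  to_pt_unique : forall (X : bcat) (f : mor X pt), f = to_pt X;
  fiber_products : forall (X Y Y' : bcat) (f : mor X Y) (g : mor Y' Y),
    exists (X' : bcat) (g' : mor X' X) (f' : mor X' Y'), cartesian g' f' f g;

  confined : forall X Y : bcat, mor X Y -> Prop;
  independent : forall X Y X' Y' : bcat,
    mor X' X -> mor X' Y' -> mor X Y -> mor Y' Y -> Prop;

  confined_id : forall X : bcat, confined (idm X);
  confined_comp : forall (X Y Z : bcat) (f : mor X Y) (g : mor Y Z),
    confined f -> confined g -> confined (g ∘ f);
  (* base change of the right side, and of the bottom side *)
  confined_left : forall (X Y X' Y' : bcat)
      (g' : mor X' X) (f' : mor X' Y') (f : mor X Y) (g : mor Y' Y),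
    independent g' f' f g -> confined f -> confined f';
  confined_top : forall (X Y X' Y' : bcat)
      (g' : mor X' X) (f' : mor X' Y') (f : mor X Y) (g : mor Y' Y),
    independent g' f' f g -> confined g -> confined g';

  independent_cartesian : forall (X Y X' Y' : bcat)
      (g' : mor X' X) (f' : mor X' Y') (f : mor X Y) (g : mor Y' Y),
    independent g' f' f g -> cartesian g' f' f g;
  (* the identity squares for horizontal and for vertical composition *)
  independent_idh : forall (X Y : bcat) (f : mor X Y),
    independent (idm X) f f (idm Y);
  independent_idv : forall (X Y : bcat) (g : mor X Y),
    independent g (idm X) (idm Y) g;
  independent_hcomp : forall (X Y X' Y' X'' Y'' : bcat)
      (g' : mor X' X) (f' : mor X' Y') (f : mor X Y) (g : mor Y' Y)
      (k' : mor X'' X') (f'' : mor X'' Y'') (k : mor Y'' Y'),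
    independent g' f' f g -> independent k' f'' f' k ->
    independent (g' ∘ k') f'' f (g ∘ k);
  independent_vcomp : forall (X Y Z X' Y' Z' : bcat)
      (h'' : mor X' X) (f' : mor X' Y') (f : mor X Y)
      (h' : mor Y' Y) (g' : mor Y' Z') (g : mor Y Z) (h : mor Z' Z),
    independent h'' f' f h' -> independent h' g' g h ->
    independent h'' (g' ∘ f') (g ∘ f) h;
  (* [X'] is a product of [X] and [Y'], with projections [p] and [q] *)
  independent_product : forall (X Y' X' : bcat) (p : mor X' X) (q : mor X' Y'),
    cartesian p q (to_pt X) (to_pt Y') -> independent p q (to_pt X) (to_pt Y')
}.

Arguments pt {b}.
Arguments to_pt {b} X.

Lemma to_pt_comp (C : bivCategory) (X Y : C) (f : mor X Y) :
  to_pt X = to_pt Y ∘ f.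
Proof. exact: esym (to_pt_unique _). Qed.

(* Independent squares can be stacked: a square over a composite splits into
   independent squares, and a square over [g] extends upwards along a confined
   [f].  This is what makes pseudo-bivariant classes compatible with products
   and pushforwards.  By [cartesian_stackable] below, both conditions hold when
   all Cartesian squares are independent. *)
Definition stackable (C : bivCategory) : Prop :=
  (forall (X Y Z X' Z' : C) (f : mor X Y) (g : mor Y Z)
      (h'' : mor X' X) (k : mor X' Z') (h : mor Z' Z),
     independent h'' k (g ∘ f) h ->
     exists (Y' : C) (h' : mor Y' Y) (f' : mor X' Y') (g' : mor Y' Z'),
       [/\ k = g' ∘ f', independent h'' f' f h' & independent h' g' g h]) /\
  (forall (X Y Z Y' Z' : C) (f : mor X Y) (g : mor Y Z)
      (h' : mor Y' Y) (g' : mor Y' Z') (h : mor Z' Z),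
     confined f -> independent h' g' g h ->
     exists (X' : C) (h'' : mor X' X) (f' : mor X' Y'),
       independent h'' f' f h').

Lemma cartesian_stackable (C : bivCategory) :
  (forall (X Y X' Y' : C)
      (g' : mor X' X) (f' : mor X' Y') (f : mor X Y) (g : mor Y' Y),
     cartesian g' f' f g -> independent g' f' f g) ->
  stackable C.
Proof.
move=> ci; split=> [X Y Z X' Z' f g h'' k h i|X Y Z Y' Z' f g h' g' h _ _].
  have [eX uX] := independent_cartesian i.
  have [Y' [h' [g' cY]]] := fiber_products g h; have [eY uY] := cY.
  have eX' : g ∘ (f ∘ h'') = h ∘ k by rewrite compA.
  have [f' [[hf' gf'] f'u]] := uY X' (f ∘ h'') k eX'.
  exists Y', h', f', g'; split=> //; last exact: ci.
  apply: ci; split=> // W a b e.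
  have eW : (g ∘ f) ∘ a = h ∘ (g' ∘ b) by rewrite -compA e compA eY compA.
  have [u [[ua ub] uu]] := uX W a (g' ∘ b) eW.
  exists u; split=> [|v [va vb]]; last by apply: uu; rewrite -gf' -compA vb.
  split=> //.
  have eV : g ∘ (f ∘ a) = h ∘ (g' ∘ b) by rewrite compA.
  have [w [_ wu]] := uY W (f ∘ a) (g' ∘ b) eV.
  rewrite -(wu (f' ∘ u)) ?(wu b) //; split=> //.
    by rewrite compA hf' -compA ua.
  by rewrite compA gf'.
by have [X' [h'' [f' /ci]]] := fiber_products f h'; exists X', h'', f'.
Qed.

(* The groups are indexed by morphisms, and composition is associative only up
   to propositional equality.  To avoid transports, the product takes values in
   B(h) for any [h] with a proof of [h = g ∘ f], and likewise for the source of
   the pushforward.  The groups carry no grading: a graded theory is covered by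
   its total groups, since the homomorphisms below need not be homogeneous. *)
Record bivariant (C : bivCategory) := Bivariant {
  bgrp :> forall X Y : C, mor X Y -> zmodType;
  bprod : forall (X Y Z : C) (f : mor X Y) (g : mor Y Z) (h : mor X Z),
    h = g ∘ f -> bgrp f -> bgrp g -> bgrp h;
  bpush : forall (X Y Z : C) (f : mor X Y) (g : mor Y Z) (h : mor X Z),
    h = g ∘ f -> confined f -> bgrp h -> bgrp g;
  bpull : forall (X Y X' Y' : C)
      (g' : mor X' X) (f' : mor X' Y') (f : mor X Y) (g : mor Y' Y),
    independent g' f' f g -> bgrp f -> bgrp f';

  bprodDl : forall (X Y Z : C) (f : mor X Y) (g : mor Y Z) (h : mor X Z)
      (e : h = g ∘ f) (b : bgrp g),
    {morph (fun a : bgrp f => bprod e a b) : x y / x + y};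
  bprodDr : forall (X Y Z : C) (f : mor X Y) (g : mor Y Z) (h : mor X Z)
      (e : h = g ∘ f) (a : bgrp f),
    {morph (fun b : bgrp g => bprod e a b) : x y / x + y};
  bpushD : forall (X Y Z : C) (f : mor X Y) (g : mor Y Z) (h : mor X Z)
      (e : h = g ∘ f) (cf : confined f),
    {morph bpush e cf : x y / x + y};
  bpullD : forall (X Y X' Y' : C)
      (g' : mor X' X) (f' : mor X' Y') (f : mor X Y) (g : mor Y' Y)
      (i : independent g' f' f g),
    {morph bpull i : x y / x + y};

  (* (α • β) • γ = α • (β • γ) *)
  bprodA : forall (X Y Z W : C) (f : mor X Y) (g : mor Y Z) (h : mor Z W)
      (gf : mor X Z) (hg : mor Y W) (hgf : mor X W)
      (e1 : gf = g ∘ f) (e2 : hg = h ∘ g) (e3 : hgf = h ∘ gf)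
      (e4 : hgf = hg ∘ f) (a : bgrp f) (b : bgrp g) (c : bgrp h),
    bprod e3 (bprod e1 a b) c = bprod e4 a (bprod e2 b c);
  bpush_id : forall (X Y : C) (f : mor X Y) (e : f = f ∘ idm X)
      (cf : confined (idm X)) (a : bgrp f),
    bpush e cf a = a;
  (* (gf)_* = g_* f_* *)
  bpush_comp : forall (X Y Z W : C) (f : mor X Y) (g : mor Y Z) (h : mor Z W)
      (gf : mor X Z) (hg : mor Y W) (hgf : mor X W)
      (e1 : gf = g ∘ f) (e2 : hg = h ∘ g) (e3 : hgf = h ∘ gf)
      (e4 : hgf = hg ∘ f) (cf : confined f) (cg : confined g)
      (cgf : confined gf) (a : bgrp hgf),
    bpush e3 cgf a = bpush e2 cg (bpush e4 cf a);
  bpull_id : forall (X Y : C) (f : mor X Y)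
      (i : independent (idm X) f f (idm Y)) (a : bgrp f),
    bpull i a = a;
  (* (gk)^* = k^* g^* *)
  bpull_comp : forall (X Y X' Y' X'' Y'' : C)
      (g' : mor X' X) (f' : mor X' Y') (f : mor X Y) (g : mor Y' Y)
      (k' : mor X'' X') (f'' : mor X'' Y'') (k : mor Y'' Y')
      (i : independent g' f' f g) (j : independent k' f'' f' k)
      (l : independent (g' ∘ k') f'' f (g ∘ k)) (a : bgrp f),
    bpull l a = bpull j (bpull i a);
  (* f_* (α • β) = f_* α • β *)
  bpush_prod : forall (X Y Z W : C) (f : mor X Y) (g : mor Y Z) (h : mor Z W)
      (gf : mor X Z) (hg : mor Y W) (hgf : mor X W)
      (e1 : gf = g ∘ f) (e2 : hg = h ∘ g) (e3 : hgf = h ∘ gf)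
      (e4 : hgf = hg ∘ f) (cf : confined f) (a : bgrp gf) (b : bgrp h),
    bpush e4 cf (bprod e3 a b) = bprod e2 (bpush e1 cf a) b;
  (* h^* (α • β) = h'^* α • h^* β *)
  bpull_prod : forall (X Y Z X' Y' Z' : C)
      (h'' : mor X' X) (f' : mor X' Y') (f : mor X Y)
      (h' : mor Y' Y) (g' : mor Y' Z') (g : mor Y Z) (h : mor Z' Z)
      (gf : mor X Z) (gf' : mor X' Z')
      (e : gf = g ∘ f) (e' : gf' = g' ∘ f')
      (i1 : independent h'' f' f h') (i2 : independent h' g' g h)
      (i : independent h'' gf' gf h) (a : bgrp f) (b : bgrp g),
    bpull i (bprod e a b) = bprod e' (bpull i1 a) (bpull i2 b);
  (* h^* (f_* α) = f'_* (h^* α) *)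
  bpull_push : forall (X Y Z X' Y' Z' : C)
      (h'' : mor X' X) (f' : mor X' Y') (f : mor X Y)
      (h' : mor Y' Y) (g' : mor Y' Z') (g : mor Y Z) (h : mor Z' Z)
      (gf : mor X Z) (gf' : mor X' Z')
      (e : gf = g ∘ f) (e' : gf' = g' ∘ f')
      (i1 : independent h'' f' f h') (i2 : independent h' g' g h)
      (i : independent h'' gf' gf h)
      (cf : confined f) (cf' : confined f') (a : bgrp gf),
    bpull i2 (bpush e cf a) = bpush e' cf' (bpull i a);
  (* g'_* (g^* α • β) = α • g_* β *)
  bproj : forall (X Y X' Y' Z : C)
      (g' : mor X' X) (f' : mor X' Y') (f : mor X Y) (g : mor Y' Y)
      (h : mor Y Z) (hg : mor Y' Z) (hf : mor X Z) (k : mor X' Z)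
      (e1 : hg = h ∘ g) (e2 : k = hg ∘ f') (e3 : k = hf ∘ g')
      (e4 : hf = h ∘ f) (i : independent g' f' f g)
      (cg : confined g) (cg' : confined g') (a : bgrp f) (b : bgrp hg),
    bpush e3 cg' (bprod e2 (bpull i a) b) = bprod e4 a (bpush e1 cg b)
}.

Arguments bprod {C} _ {X Y Z f g h} _ _ _.
Arguments bpush {C} _ {X Y Z f g h} _ _ _.
Arguments bpull {C} _ {X Y X' Y' g' f' f g} _ _.

Record grothendieck (C : bivCategory) (B B' : bivariant C) := Grothendieck {
  gmap :> forall (X Y : C) (f : mor X Y), B X Y f -> B' X Y f;
  gmapD : forall (X Y : C) (f : mor X Y), {morph @gmap X Y f : a b / a + b};
  gmap_prod : forall (X Y Z : C) (f : mor X Y) (g : mor Y Z) (h : mor X Z)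
      (e : h = g ∘ f) (a : B X Y f) (b : B Y Z g),
    gmap (bprod B e a b) = bprod B' e (gmap a) (gmap b);
  gmap_push : forall (X Y Z : C) (f : mor X Y) (g : mor Y Z) (h : mor X Z)
      (e : h = g ∘ f) (cf : confined f) (a : B X Z h),
    gmap (bpush B e cf a) = bpush B' e cf (gmap a);
  gmap_pull : forall (X Y X' Y' : C)
      (g' : mor X' X) (f' : mor X' Y') (f : mor X Y) (g : mor Y' Y)
      (i : independent g' f' f g) (a : B X Y f),
    gmap (bpull B i a) = bpull B' i (gmap a)
}.

Section Covariant.
Variables (C : bivCategory) (B : bivariant C).

(* B_*(X) *)
Definition cov (X : C) : zmodType := B X pt (to_pt X).

Definition cov_push (X Y : C) (f : mor X Y) (cf : confined f) :
  cov X -> cov Y := bpush B (to_pt_comp f) cf.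

(* the product B(X -> Y) x B_*(Y) -> B_*(X) *)
Definition act (X Y : C) (f : mor X Y) (a : B X Y f) (b : cov Y) : cov X :=
  bprod B (to_pt_comp f) a b.

(* the exterior product with values in B_*(X'), where [X'] is a product of [X]
   and [Y'] *)
Definition extprod (X Y' X' : C) (p : mor X' X) (q : mor X' Y')
    (i : cartesian p q (to_pt X) (to_pt Y')) (a : cov X) (b : cov Y') :
  cov X' := act (bpull B (independent_product i) a) b.

(* [u] is a two-sided unit for the products with source or target [pt -> pt] *)
Definition is_unit_pt (u : cov pt) : Prop :=
  (forall (X : C) (f : mor X pt) (e : f = to_pt pt ∘ f) (a : B X pt f),
     bprod B e a u = a) /\
  (forall (Y : C) (f : mor pt Y) (e : f = f ∘ to_pt pt) (b : B pt Y f),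
     bprod B e u b = b).

End Covariant.

Record covTransformation (C : bivCategory) (F H : bivariant C) :=
  CovTransformation {
  cmap :> forall X : C, cov F X -> cov H X;
  cmapD : forall X : C, {morph @cmap X : a b / a + b};
  cmap_push : forall (X Y : C) (f : mor X Y) (cf : confined f) (a : cov F X),
    cmap (cov_push cf a) = cov_push cf (cmap a)
}.

Definition commutes_extprod (C : bivCategory) (F H : bivariant C)
    (c : covTransformation F H) : Prop :=
  forall (X Y' X' : C) (p : mor X' X) (q : mor X' Y')
    (i : cartesian p q (to_pt X) (to_pt Y')) (a : cov F X) (b : cov F Y'),
  c X' (extprod i a b) = extprod i (c X a) (c Y' b).

Lemma morphD0 (U V : zmodType) (f : U -> V) :
  {morph f : x y / x + y} -> f 0 = 0.
Proof. by move=> fD; apply: (addrI (f 0)); rewrite -fD !addr0. Qed.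

Lemma morphDN (U V : zmodType) (f : U -> V) :
  {morph f : x y / x + y} -> {morph f : x / - x}.
Proof.
by move=> fD x; apply: (addrI (f x)); rewrite -fD !subrr (morphD0 fD).
Qed.

Lemma morphDB (U V : zmodType) (f : U -> V) :
  {morph f : x y / x + y} -> {morph f : x y / x - y}.
Proof. by move=> fD x y; rewrite fD (morphDN fD). Qed.

Definition is_subgroup (V : zmodType) (P : V -> Prop) : Prop :=
  P 0 /\ forall x y, P x -> P y -> P (x - y).

Section Subgroup.
Variables (V : zmodType) (P : V -> Prop) (hP : is_subgroup P).

Definition subgroup_pred (_ : is_subgroup P) : {pred V} := fun x => `[< P x >].

Lemma subgroup_closed : zmod_closed (subgroup_pred hP).
Proof.
case: (hP) => h0 hB; split=> [|x y /asboolP Px /asboolP Py]; apply/asboolP.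
  exact: h0.
exact: hB.
Qed.

HB.instance Definition _ :=
  GRing.isZmodClosed.Build V (subgroup_pred hP) subgroup_closed.

Record subgroup := Subgroup {
  sub_val :> V;
  sub_valP : sub_val \in subgroup_pred hP
}.

HB.instance Definition _ := [isSub for sub_val].
HB.instance Definition _ := [Choice of subgroup by <:].
HB.instance Definition _ := [SubChoice_isSubZmodule of subgroup by <:].

Definition insubgroup (x : V) (Px : P x) : subgroup := Subgroup (asboolT Px).

Lemma subgroupP (x : subgroup) : P (sub_val x).
Proof. exact/asboolP/sub_valP. Qed.

Lemma subgroup_inj : injective sub_val.
Proof. exact: val_inj. Qed.

Lemma sub_valD : {morph sub_val : x y / x + y}.
Proof. by []. Qed.

End Subgroup.

Record is_congruence (V : zmodType) (R : V -> V -> Prop) : Prop :=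
  IsCongruence {
  congr_refl : forall x, R x x;
  congr_sym : forall x y, R x y -> R y x;
  congr_trans : forall x y z, R x y -> R y z -> R x z;
  congr_add : forall x x' y y', R x x' -> R y y' -> R (x + y) (x' + y');
  congr_opp : forall x x', R x x' -> R (- x) (- x')
}.

Section QuotientGroup.
Variables (V : zmodType) (R : V -> V -> Prop) (hR : is_congruence R).

Definition quotgroup_rel (_ : is_congruence R) : rel V :=
  fun x y => `[< R x y >].

Lemma quotgroup_equiv : equiv_class_of (quotgroup_rel hR).
Proof.
split=> [x|x y|y x z].
- exact/asboolP/(congr_refl hR).
- by apply/asboolP/asboolP; exact: (congr_sym hR).
- by move=> /asboolP xy /asboolP yz; apply/asboolP/(congr_trans hR xy yz).
Qed.

Canonical quotgroup_equiv_rel := EquivRelPack quotgroup_equiv.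

Definition quotgroup := {eq_quot quotgroup_equiv_rel}.

HB.instance Definition _ := Choice.on quotgroup.
HB.instance Definition _ := EqQuotient.on quotgroup.

Definition qclass (x : V) : quotgroup := \pi_quotgroup x.

Lemma classP (x y : V) : qclass x = qclass y <-> R x y.
Proof.
split=> [/eqP|h]; first by rewrite /qclass eqmodE => /asboolP.
by apply/eqP; rewrite /qclass eqmodE; apply/asboolP.
Qed.

Lemma classK (x : quotgroup) : qclass (repr x) = x.
Proof. exact: reprK. Qed.

Lemma repr_class (x : V) : R (repr (qclass x)) x.
Proof. by apply/classP; rewrite classK. Qed.

Lemma classW (P : quotgroup -> Prop) : (forall x, P (qclass x)) -> forall x, P x.
Proof. by move=> h x; rewrite -[x]classK; apply: h. Qed.

Definition quot_add (x y : quotgroup) := qclass (repr x + repr y).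
Definition quot_opp (x : quotgroup) := qclass (- repr x).

Lemma quot_addE x y : quot_add (qclass x) (qclass y) = qclass (x + y).
Proof. by apply/classP/(congr_add hR); exact: repr_class. Qed.

Lemma quot_oppE x : quot_opp (qclass x) = qclass (- x).
Proof. by apply/classP/(congr_opp hR)/repr_class. Qed.

Lemma quot_addA : associative quot_add.
Proof.
elim/classW=> x; elim/classW=> y; elim/classW=> z.
by rewrite !quot_addE addrA.
Qed.

Lemma quot_addC : commutative quot_add.
Proof. by elim/classW=> x; elim/classW=> y; rewrite !quot_addE addrC. Qed.

Lemma quot_add0 : left_id (qclass 0) quot_add.
Proof. by elim/classW=> x; rewrite quot_addE add0r. Qed.

Lemma quot_addN : left_inverse (qclass 0) quot_opp quot_add.
Proof. by elim/classW=> x; rewrite quot_oppE quot_addE addNr. Qed.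

HB.instance Definition _ := GRing.isZmodule.Build quotgroup
  quot_addA quot_addC quot_add0 quot_addN.

Lemma classD : {morph qclass : x y / x + y}.
Proof. by move=> x y; rewrite -quot_addE. Qed.

End QuotientGroup.

Section Associated.
Variables (C : bivCategory) (F H : bivariant C) (c : covTransformation F H).

Definition pseudo_bivariant (X Y : C) (f : mor X Y)
    (a : F X Y f) (B : H X Y f) : Prop :=
  forall (X' Y' : C) (g' : mor X' X) (f' : mor X' Y') (g : mor Y' Y)
    (i : independent g' f' f g) (b : cov F Y'),
  c X' (act (bpull F i a) b) = act (bpull H i B) (c Y' b).

Definition inFtilde (X Y : C) (f : mor X Y) (a : F X Y f) : Prop :=
  exists B : H X Y f, pseudo_bivariant a B.

Section BilinearFacts.
Variable B : bivariant C.

Lemma actDl (X Y : C) (f : mor X Y) (b : cov B Y) :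
  {morph (fun a : B X Y f => act a b) : x y / x + y}.
Proof. exact: bprodDl. Qed.

Lemma actDr (X Y : C) (f : mor X Y) (a : B X Y f) :
  {morph (fun b : cov B Y => act a b) : x y / x + y}.
Proof. exact: bprodDr. Qed.

Lemma act_prod (X Y Z : C) (f : mor X Y) (g : mor Y Z) (h : mor X Z)
    (e : h = g ∘ f) (a : B X Y f) (a' : B Y Z g) (b : cov B Z) :
  act (bprod B e a a') b = act a (act a' b).
Proof. exact: bprodA. Qed.

Lemma act_push (X Y Z : C) (f : mor X Y) (g : mor Y Z) (h : mor X Z)
    (e : h = g ∘ f) (cf : confined f) (a : B X Z h) (b : cov B Z) :
  act (bpush B e cf a) b = cov_push cf (act a b).
Proof. exact/esym/bpush_prod. Qed.

Lemma bpull_bpull (X Y X' Y' X'' Y'' : C)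
    (g' : mor X' X) (f' : mor X' Y') (f : mor X Y) (g : mor Y' Y)
    (k' : mor X'' X') (f'' : mor X'' Y'') (k : mor Y'' Y')
    (i : independent g' f' f g) (j : independent k' f'' f' k) (a : B X Y f) :
  bpull B j (bpull B i a) = bpull B (independent_hcomp i j) a.
Proof. exact/esym/bpull_comp. Qed.

End BilinearFacts.

Lemma pseudo0 (X Y : C) (f : mor X Y) :
  pseudo_bivariant (0 : F X Y f) (0 : H X Y f).
Proof.
move=> X' Y' g' f' g i b.
rewrite !(morphD0 (bpullD _)) (morphD0 (actDl b)) (morphD0 (actDl _)).
exact: morphD0 (@cmapD _ _ _ c X').
Qed.

Lemma pseudoB (X Y : C) (f : mor X Y) (a a' : F X Y f) (B B' : H X Y f) :
  pseudo_bivariant a B -> pseudo_bivariant a' B' ->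
  pseudo_bivariant (a - a') (B - B').
Proof.
move=> h h' X' Y' g' f' g i b.
rewrite !(morphDB (bpullD _)) (morphDB (actDl b)) (morphDB (actDl _)).
by rewrite (morphDB (@cmapD _ _ _ c X')) h h'.
Qed.

Lemma pseudo_pull (X Y X' Y' : C)
    (g' : mor X' X) (f' : mor X' Y') (f : mor X Y) (g : mor Y' Y)
    (i : independent g' f' f g) (a : F X Y f) (B : H X Y f) :
  pseudo_bivariant a B -> pseudo_bivariant (bpull F i a) (bpull H i B).
Proof. by move=> h X'' Y'' k' f'' k j b; rewrite !bpull_bpull h. Qed.

Section Stackable.
Hypothesis hC : stackable C.

Lemma pseudo_prod (X Y Z : C) (f : mor X Y) (g : mor Y Z) (h : mor X Z)
    (e : h = g ∘ f) (a : F X Y f) (a' : F Y Z g) (B : H X Y f) (B' : H Y Z g) :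
  pseudo_bivariant a B -> pseudo_bivariant a' B' ->
  pseudo_bivariant (bprod F e a a') (bprod H e B B').
Proof.
move=> pa pa' X' Z' k' f'' k i b; subst h.
have [Y' [h' [f' [g' [ef i1 i2]]]]] := hC.1 _ _ _ _ _ _ _ _ _ _ i.
by rewrite !(bpull_prod _ ef i1 i2) !act_prod pa pa'.
Qed.

Lemma pseudo_push (X Y Z : C) (f : mor X Y) (g : mor Y Z) (h : mor X Z)
    (e : h = g ∘ f) (cf : confined f) (a : F X Z h) (B : H X Z h) :
  pseudo_bivariant a B -> pseudo_bivariant (bpush F e cf a) (bpush H e cf B).
Proof.
move=> pa Y' Z' h' g' k i2 b; subst h.
have [X' [h'' [f' i1]]] := hC.2 _ _ _ _ _ _ _ _ _ _ cf i2.
have i := independent_vcomp i1 i2; have cf' := confined_left i1 cf.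
by rewrite !(bpull_push _ erefl i1 i2 i cf cf') !act_push cmap_push pa.
Qed.

Lemma inFtilde_subgroup (X Y : C) (f : mor X Y) : is_subgroup (@inFtilde X Y f).
Proof.
split=> [|x y [B hB] [B' hB']]; first by exists 0; exact: pseudo0.
by exists (B - B'); exact: pseudoB.
Qed.

Definition FT (X Y : C) (f : mor X Y) : zmodType :=
  subgroup (@inFtilde_subgroup X Y f).

Definition FTprod (X Y Z : C) (f : mor X Y) (g : mor Y Z) (h : mor X Z)
    (e : h = g ∘ f) (a : FT f) (b : FT g) : FT h.
Proof.
apply: (@insubgroup _ _ _ (bprod F e (sub_val a) (sub_val b))).
case: (subgroupP a) (subgroupP b) => B hB [B' hB'].
by exists (bprod H e B B'); exact: pseudo_prod.
Defined.

Definition FTpush (X Y Z : C) (f : mor X Y) (g : mor Y Z) (h : mor X Z)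
    (e : h = g ∘ f) (cf : confined f) (a : FT h) : FT g.
Proof.
apply: (@insubgroup _ _ _ (bpush F e cf (sub_val a))).
by case: (subgroupP a) => B hB; exists (bpush H e cf B); exact: pseudo_push.
Defined.

Definition FTpull (X Y X' Y' : C)
    (g' : mor X' X) (f' : mor X' Y') (f : mor X Y) (g : mor Y' Y)
    (i : independent g' f' f g) (a : FT f) : FT f'.
Proof.
apply: (@insubgroup _ _ _ (bpull F i (sub_val a))).
by case: (subgroupP a) => B hB; exists (bpull H i B); exact: pseudo_pull.
Defined.

Definition Ftilde : bivariant C.
Proof.
apply: (@Bivariant C FT FTprod FTpush FTpull);
  try by intros; intros ? ?; apply: subgroup_inj;
    rewrite /= ?bprodDl ?bprodDr ?bpushD ?bpullD.
- by intros; apply: subgroup_inj; exact: bprodA.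
- by intros; apply: subgroup_inj; exact: bpush_id.
- by intros; apply: subgroup_inj; exact: bpush_comp.
- by intros; apply: subgroup_inj; exact: bpull_id.
- by intros; apply: subgroup_inj; exact: bpull_comp.
- by intros; apply: subgroup_inj; exact: bpush_prod.
- by intros; apply: subgroup_inj; exact: bpull_prod.
- by intros; apply: subgroup_inj; exact: bpull_push.
- by intros; apply: subgroup_inj; exact: bproj.
Defined.

Definition inPH (X Y : C) (f : mor X Y) (B : H X Y f) : Prop :=
  exists a : F X Y f, inFtilde a /\ pseudo_bivariant a B.

Lemma inPH_subgroup (X Y : C) (f : mor X Y) : is_subgroup (@inPH X Y f).
Proof.
split=> [|x y [a [_ ha]] [a' [_ ha']]].
  by exists 0; split; [exists 0|]; exact: pseudo0.
by exists (a - a'); split; [exists (x - y)|]; exact: pseudoB.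
Qed.

Definition PH (X Y : C) (f : mor X Y) : zmodType :=
  subgroup (@inPH_subgroup X Y f).

Definition PHprod (X Y Z : C) (f : mor X Y) (g : mor Y Z) (h : mor X Z)
    (e : h = g ∘ f) (B : PH f) (B' : PH g) : PH h.
Proof.
apply: (@insubgroup _ _ _ (bprod H e (sub_val B) (sub_val B'))).
case: (subgroupP B) (subgroupP B') => a [_ ha] [a' [_ ha']].
exists (bprod F e a a'); split; last exact: pseudo_prod.
by exists (bprod H e (sub_val B) (sub_val B')); exact: pseudo_prod.
Defined.

Definition PHpush (X Y Z : C) (f : mor X Y) (g : mor Y Z) (h : mor X Z)
    (e : h = g ∘ f) (cf : confined f) (B : PH h) : PH g.
Proof.
apply: (@insubgroup _ _ _ (bpush H e cf (sub_val B))).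
case: (subgroupP B) => a [_ ha].
exists (bpush F e cf a); split; last exact: pseudo_push.
by exists (bpush H e cf (sub_val B)); exact: pseudo_push.
Defined.

Definition PHpull (X Y X' Y' : C)
    (g' : mor X' X) (f' : mor X' Y') (f : mor X Y) (g : mor Y' Y)
    (i : independent g' f' f g) (B : PH f) : PH f'.
Proof.
apply: (@insubgroup _ _ _ (bpull H i (sub_val B))).
case: (subgroupP B) => a [_ ha].
exists (bpull F i a); split; last exact: pseudo_pull.
by exists (bpull H i (sub_val B)); exact: pseudo_pull.
Defined.

Definition PHequiv (X Y : C) (f : mor X Y) (B B' : PH f) : Prop :=
  forall (X' Y' : C) (g' : mor X' X) (f' : mor X' Y') (g : mor Y' Y)
    (i : independent g' f' f g) (b : cov F Y'),
  act (bpull H i (sub_val B)) (c Y' b) = act (bpull H i (sub_val B')) (c Y' b).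

Lemma PHequiv_congruence (X Y : C) (f : mor X Y) :
  is_congruence (@PHequiv X Y f).
Proof.
split=> [//|B B' h|B1 B2 B3 h h'|B1 B1' B2 B2' h h'|B B' h] X' Y' g' f' g i b.
- by rewrite h.
- by rewrite h h'.
- by rewrite !sub_valD !bpullD (actDl (c Y' b)) h h' -actDl.
- rewrite !(morphDN (@sub_valD _ _ _)) !(morphDN (bpullD _)).
  by rewrite !(morphDN (actDl (c Y' b))) h.
Qed.

Definition HT (X Y : C) (f : mor X Y) : zmodType :=
  quotgroup (@PHequiv_congruence X Y f).

Definition HTclass (X Y : C) (f : mor X Y) (B : PH f) : HT f :=
  qclass (@PHequiv_congruence X Y f) B.

Definition HTprod (X Y Z : C) (f : mor X Y) (g : mor Y Z) (h : mor X Z)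
    (e : h = g ∘ f) (x : HT f) (y : HT g) : HT h :=
  HTclass (PHprod e (repr x) (repr y)).

Definition HTpush (X Y Z : C) (f : mor X Y) (g : mor Y Z) (h : mor X Z)
    (e : h = g ∘ f) (cf : confined f) (x : HT h) : HT g :=
  HTclass (PHpush e cf (repr x)).

Definition HTpull (X Y X' Y' : C)
    (g' : mor X' X) (f' : mor X' Y') (f : mor X Y) (g : mor Y' Y)
    (i : independent g' f' f g) (x : HT f) : HT f' :=
  HTclass (PHpull i (repr x)).

Lemma HTclassP (X Y : C) (f : mor X Y) (B B' : PH f) :
  HTclass B = HTclass B' <-> PHequiv B B'.
Proof. exact: classP. Qed.

Lemma HTclassD (X Y : C) (f : mor X Y) : {morph @HTclass X Y f : x y / x + y}.
Proof. exact: classD. Qed.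

Lemma HTclassW (X Y : C) (f : mor X Y) (P : HT f -> Prop) :
  (forall B, P (HTclass B)) -> forall x, P x.
Proof. exact: classW. Qed.

(* the operations of [HT] are computed on arbitrary representatives *)
Lemma HTprodE (X Y Z : C) (f : mor X Y) (g : mor Y Z) (h : mor X Z)
    (e : h = g ∘ f) (B : PH f) (B' : PH g) :
  HTprod e (HTclass B) (HTclass B') = HTclass (PHprod e B B').
Proof.
apply/HTclassP => X' Z' k' f'' k i b; subst h; rewrite /=.
have [Y' [h' [f' [g' [ef i1 i2]]]]] := hC.1 _ _ _ _ _ _ _ _ _ _ i.
rewrite !(bpull_prod _ ef i1 i2) !act_prod.
have -> := @repr_class _ _ (@PHequiv_congruence _ _ _) B' _ _ _ _ _ i2 b.
have [a' [_ ha']] := subgroupP B'.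
rewrite -ha'.
exact: (@repr_class _ _ (@PHequiv_congruence _ _ _) B _ _ _ _ _ i1).
Qed.

Lemma HTpushE (X Y Z : C) (f : mor X Y) (g : mor Y Z) (h : mor X Z)
    (e : h = g ∘ f) (cf : confined f) (B : PH h) :
  HTpush e cf (HTclass B) = HTclass (PHpush e cf B).
Proof.
apply/HTclassP => Y' Z' h' g' k i2 b; subst h; rewrite /=.
have [X' [h'' [f' i1]]] := hC.2 _ _ _ _ _ _ _ _ _ _ cf i2.
have i := independent_vcomp i1 i2; have cf' := confined_left i1 cf.
rewrite !(bpull_push _ erefl i1 i2 i cf cf') !act_push; congr (cov_push _ _).
exact: (@repr_class _ _ (@PHequiv_congruence _ _ _) B).
Qed.

Lemma HTpullE (X Y X' Y' : C)
    (g' : mor X' X) (f' : mor X' Y') (f : mor X Y) (g : mor Y' Y)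
    (i : independent g' f' f g) (B : PH f) :
  HTpull i (HTclass B) = HTclass (PHpull i B).
Proof.
apply/HTclassP => X'' Y'' k' f'' k j b; rewrite /= !bpull_bpull.
exact: (@repr_class _ _ (@PHequiv_congruence _ _ _) B).
Qed.

Definition Htilde : bivariant C.
Proof.
apply: (@Bivariant C HT HTprod HTpush HTpull).
- intros ? ? ? ? ? ? e; elim/HTclassW=> B; elim/HTclassW=> x; elim/HTclassW=> y.
  rewrite -HTclassD !HTprodE -HTclassD; congr HTclass.
  by apply: subgroup_inj; rewrite /= bprodDl.
- intros ? ? ? ? ? ? e; elim/HTclassW=> B; elim/HTclassW=> x; elim/HTclassW=> y.
  rewrite -HTclassD !HTprodE -HTclassD; congr HTclass.
  by apply: subgroup_inj; rewrite /= bprodDr.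
- intros ? ? ? ? ? ? e cf; elim/HTclassW=> x; elim/HTclassW=> y.
  rewrite -HTclassD !HTpushE -HTclassD; congr HTclass.
  by apply: subgroup_inj; rewrite /= bpushD.
- intros ? ? ? ? ? ? ? ? i; elim/HTclassW=> x; elim/HTclassW=> y.
  rewrite -HTclassD !HTpullE -HTclassD; congr HTclass.
  by apply: subgroup_inj; rewrite /= bpullD.
- intros; move: a b c0; elim/HTclassW=> x; elim/HTclassW=> y; elim/HTclassW=> z.
  by rewrite !HTprodE; congr HTclass; apply: subgroup_inj; exact: bprodA.
- intros; move: a; elim/HTclassW=> x.
  by rewrite !HTpushE; congr HTclass; apply: subgroup_inj; exact: bpush_id.
- intros; move: a; elim/HTclassW=> x.
  by rewrite !HTpushE; congr HTclass; apply: subgroup_inj; exact: bpush_comp.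
- intros; move: a; elim/HTclassW=> x.
  by rewrite !HTpullE; congr HTclass; apply: subgroup_inj; exact: bpull_id.
- intros; move: a; elim/HTclassW=> x.
  by rewrite !HTpullE; congr HTclass; apply: subgroup_inj; exact: bpull_comp.
- intros; move: a b; elim/HTclassW=> x; elim/HTclassW=> y.
  rewrite HTprodE !HTpushE HTprodE; congr HTclass.
  by apply: subgroup_inj; exact: bpush_prod.
- intros; move: a b; elim/HTclassW=> x; elim/HTclassW=> y.
  rewrite HTprodE !HTpullE HTprodE; congr HTclass.
  by apply: subgroup_inj; exact: bpull_prod.
- intros; move: a; elim/HTclassW=> x.
  rewrite HTpushE !HTpullE HTpushE; congr HTclass.
  by apply: subgroup_inj; exact: bpull_push.
- intros; move: a b; elim/HTclassW=> x; elim/HTclassW=> y.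
  rewrite HTpullE HTprodE !HTpushE HTprodE; congr HTclass.
  by apply: subgroup_inj; exact: bproj.
Defined.

Lemma inIm_subgroup (X : C) :
  is_subgroup (fun y : cov H X => exists a : cov F X, c X a = y).
Proof.
split=> [|_ _ [a <-] [b <-]]; first by exists 0; exact: (morphD0 (@cmapD _ _ _ c X)).
by exists (a - b); exact: (morphDB (@cmapD _ _ _ c X)).
Qed.

Definition Imc (X : C) : zmodType := subgroup (inIm_subgroup X).

Definition to_Imc (X : C) (a : cov F X) : Imc X :=
  insubgroup (inIm_subgroup X) (ex_intro _ a erefl).

Hypothesis cX : commutes_extprod c.

Lemma pseudo_pt (X : C) (a : cov F X) : pseudo_bivariant a (c X a).
Proof.
move=> X' Y' g' f' g i b; move: (to_pt_unique g) => eg; subst g.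
have := cX (independent_cartesian i) a b.
by rewrite /extprod (Prop_irrelevance (independent_product _) i).
Qed.

(* the identification F(X) = Ftilde(X -> pt) *)
Definition Ftilde_pt (X : C) (a : cov F X) : cov Ftilde X :=
  insubgroup (inFtilde_subgroup (to_pt X))
    (ex_intro (fun B => pseudo_bivariant a B) (c X a) (pseudo_pt a)).

Lemma Im_inPH (X : C) (y : Imc X) : inPH (sub_val y : H X pt (to_pt X)).
Proof.
have [a ay] := subgroupP y; exists a; rewrite -ay.
by split; [exists (c X a)|]; exact: pseudo_pt.
Qed.

(* the identification of the image of c_X with Htilde(X -> pt), y |-> [y] *)
Definition Htilde_pt (X : C) (y : Imc X) : cov Htilde X :=
  HTclass (insubgroup (inPH_subgroup (to_pt X)) (Im_inPH y)).

(* [Ftilde_pt] and [Htilde_pt] are isomorphisms of groups, compatible with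
   pushforwards *)
Lemma Ftilde_ptD (X : C) : {morph @Ftilde_pt X : x y / x + y}.
Proof. by move=> x y; apply: subgroup_inj. Qed.

Lemma Ftilde_pt_bij (X : C) : bijective (@Ftilde_pt X).
Proof. by exists (fun a => sub_val a) => // a; apply: subgroup_inj. Qed.

Lemma Ftilde_pt_push (X Y : C) (f : mor X Y) (cf : confined f) (a : cov F X) :
  Ftilde_pt (cov_push cf a) = cov_push cf (Ftilde_pt a).
Proof. exact: subgroup_inj. Qed.

Lemma Htilde_ptD (X : C) : {morph @Htilde_pt X : x y / x + y}.
Proof.
by move=> x y; rewrite /Htilde_pt -HTclassD; congr HTclass; apply: subgroup_inj.
Qed.

Lemma Htilde_pt_push (X Y : C) (f : mor X Y) (cf : confined f) (y : Imc X)
    (z : Imc Y) :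
  sub_val z = cov_push cf (sub_val y) ->
  Htilde_pt z = cov_push cf (Htilde_pt y).
Proof.
move=> zy; rewrite /Htilde_pt /cov_push /= HTpushE; congr HTclass.
exact: subgroup_inj.
Qed.

Lemma PHequiv_pt (oneF : cov F pt) (oneH : cov H pt) :
    is_unit_pt oneH -> c pt oneF = oneH ->
  forall (X : C) (B B' : PH (to_pt X)), PHequiv B B' -> B = B'.
Proof.
move=> [uH _] c1 X B B'.
have act1 (x : H X pt (to_pt X)) : act x oneH = x by exact: uH.
move/(_ _ _ _ _ _ (independent_idh (to_pt X)) oneF).
by rewrite !bpull_id c1 !act1 => /subgroup_inj.
Qed.

Lemma Htilde_pt_bij (oneF : cov F pt) (oneH : cov H pt) :
    is_unit_pt oneF -> is_unit_pt oneH -> c pt oneF = oneH ->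
  forall X : C, bijective (@Htilde_pt X).
Proof.
move=> [uF _] hH c1 X.
have PHIm (B : PH (to_pt X)) : exists a : cov F X, c X a = sub_val B.
  have [a [_ ha]] := subgroupP B; exists a.
  have := ha _ _ _ _ _ (independent_idh (to_pt X)) oneF.
  have actF (x : F X pt (to_pt X)) : act x oneF = x by exact: uF.
  have actH (x : H X pt (to_pt X)) : act x oneH = x by exact: hH.1.
  by rewrite !bpull_id c1 actF actH.
exists (fun x : HT (to_pt X) => insubgroup (inIm_subgroup X) (PHIm (repr x))).
- move=> y; apply: subgroup_inj => /=.
  have := @repr_class _ _ (@PHequiv_congruence _ _ _)
    (insubgroup (inPH_subgroup (to_pt X)) (Im_inPH y)).
  by move/(PHequiv_pt hH c1) => /(congr1 (fun z => sub_val z)).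
- elim/HTclassW=> B; apply/HTclassP.
  have e := PHequiv_pt hH c1 (@repr_class _ _ (@PHequiv_congruence _ _ _) B).
  rewrite (_ : insubgroup _ _ = B); first exact: (congr_refl (@PHequiv_congruence _ _ _)).
  by apply: subgroup_inj => /=; rewrite e.
Qed.

End Stackable.
End Associated.

(* Main.v *)
Require Import Defs.
From mathcomp Require Import all_boot all_algebra.
From mathcomp Require Import boolp.

(** Any two pseudo-bivariant classes of the same α are equivalent, since both
    sides of the relation are then [c_*(g^*α • β')]; so α is sent to the class of
    any of them.  Conversely a transformation γ extending [c_*] sends
    [g^*α • β'], a class over [pt], to [c_*(g^*α • β')], while compatibility
    with pullback and product gives [g^*γ(α) • c_*(β')]; so any representative of
    γ(α) is itself a pseudo-bivariant class of α, up to equivalence. *)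

Set Implicit Arguments.
Unset Strict Implicit.
Unset Printing Implicit Defensive.

(** The preservation laws are propositions, so proof irrelevance leaves only the underlying maps to
    compare. *)
Lemma grothendieck_ext (C : bivCategory) (B B' : bivariant C)
    (g g' : grothendieck B B') :
  (forall (X Y : C) (f : mor X Y) (a : B X Y f), g X Y f a = g' X Y f a) ->
  g = g'.
Proof.
case: g g' => [m D P S L] [m' D' P' S' L'] /= e.
have em : m = m'.
  by do 3![apply: functional_extensionality_dep => ?]; apply: funext => a; exact: e.
subst m'.
by rewrite (Prop_irrelevance D D') (Prop_irrelevance P P')
  (Prop_irrelevance S S') (Prop_irrelevance L L').
Qed.

Section Gamma.
Variables (C : bivCategory) (hC : stackable C) (F H : bivariant C).
Variable c : covTransformation F H.

Local Notation FT := (Ftilde c hC).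
Local Notation HT := (Htilde c hC).

Lemma pseudo_inPH (X Y : C) (f : mor X Y) (a : F X Y f) (B : H X Y f) :
  pseudo_bivariant c a B -> inPH c B.
Proof. by move=> aB; exists a; split=> //; exists B. Qed.

Definition gamma_PH (X Y : C) (f : mor X Y) (a : FT X Y f) : PH c f :=
  let: exist B aB := cid (subgroupP a) in
  insubgroup (inPH_subgroup c f) (pseudo_inPH aB).

Definition gamma_fun (X Y : C) (f : mor X Y) (a : FT X Y f) : HT X Y f :=
  HTclass (gamma_PH a).

Lemma gamma_PHP (X Y : C) (f : mor X Y) (a : FT X Y f) :
  pseudo_bivariant c (sub_val a) (sub_val (gamma_PH a)).
Proof. by rewrite /gamma_PH; case: cid. Qed.

(** Makes the choice by [cid] in [gamma_PH] harmless: each law of [gamma_tilde] reduces to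
    exhibiting one pseudo-bivariant class of the result. *)
Lemma gamma_funE (X Y : C) (f : mor X Y) (a : FT X Y f) (B : PH c f) :
  pseudo_bivariant c (sub_val a) (sub_val B) -> gamma_fun a = HTclass B.
Proof.
move=> aB; apply/HTclassP => X' Y' g' f' g i b.
by rewrite -(aB _ _ _ _ _ i) -(gamma_PHP a i b).
Qed.

Lemma pseudoD (X Y : C) (f : mor X Y) (a a' : F X Y f) (B B' : H X Y f) :
  pseudo_bivariant c a B -> pseudo_bivariant c a' B' ->
  pseudo_bivariant c (a + a')%R (B + B')%R.
Proof.
move=> h h' X' Y' g' f' g i b.
by rewrite !bpullD (actDl b) (actDl (c Y' b)) cmapD h h'.
Qed.

Definition gamma_tilde : grothendieck FT HT.
Proof.
apply: (@Grothendieck C FT HT gamma_fun).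
(* Only the right-hand occurrences are unfolded, into a class of chosen representatives; the left
   one is kept for [gamma_funE]. *)
- move=> X Y f a b; rewrite {2 3}/gamma_fun -HTclassD.
  by apply: gamma_funE; apply: pseudoD; exact: gamma_PHP.
- move=> X Y Z f g h e a b; rewrite /= {2 3}/gamma_fun HTprodE.
  by apply: gamma_funE; apply: pseudo_prod => //; exact: gamma_PHP.
- move=> X Y Z f g h e cf a; rewrite /= {2}/gamma_fun HTpushE.
  by apply: gamma_funE; apply: pseudo_push => //; exact: gamma_PHP.
- move=> X Y X' Y' g' f' f g i a; rewrite /= {2}/gamma_fun HTpullE.
  by apply: gamma_funE; apply: pseudo_pull; exact: gamma_PHP.
Defined.

Hypothesis cX : commutes_extprod c.

Definition extends_cov (g : grothendieck FT HT) : Prop :=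
  forall (X : C) (a : cov F X),
    g X pt (to_pt X) (Ftilde_pt hC cX a) = Htilde_pt hC cX (to_Imc c a).

(** Compatibility with exterior products makes [c X a] itself a pseudo-bivariant class of [a]. *)
Lemma gamma_tilde_extends : extends_cov gamma_tilde.
Proof. by move=> X a; apply: gamma_funE; exact: pseudo_pt. Qed.

Lemma extends_cov_pseudo (oneF : cov F pt) (oneH : cov H pt) :
    is_unit_pt oneH -> c pt oneF = oneH ->
  forall g : grothendieck FT HT, extends_cov g ->
  forall (X Y : C) (f : mor X Y) (a : FT X Y f) (B : PH c f),
    g X Y f a = HTclass B -> pseudo_bivariant c (sub_val a) (sub_val B).
Proof.
move=> uH c1 g gc X Y f a B gaB X' Y' k' f' k i b.
have := gmap_prod g (to_pt_comp f') (bpull FT i a) (Ftilde_pt hC cX b).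
rewrite gmap_pull gc gaB /= HTpullE /Htilde_pt HTprodE.
(* The product lies over [pt], so the extension hypothesis [gc] determines its image. *)
have -> : FTprod hC (to_pt_comp f') (FTpull i a) (Ftilde_pt hC cX b)
    = Ftilde_pt hC cX (act (bpull F i (sub_val a)) b) by exact: subgroup_inj.
(* Over [pt], testing on the unit along the identity square turns equivalence into equality. *)
rewrite gc => /HTclassP /(PHequiv_pt uH c1).
by move/(congr1 (fun z => sub_val z)).
Qed.

Lemma extends_cov_unique (oneF : cov F pt) (oneH : cov H pt) :
    is_unit_pt oneH -> c pt oneF = oneH ->
  forall g : grothendieck FT HT, extends_cov g -> gamma_tilde = g.
Proof.
move=> uH c1 g gc; apply: grothendieck_ext => X Y f a.
have [B gaB] : exists B, g X Y f a = HTclass B.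
  by move: (g X Y f a); elim/HTclassW => B; exists B.
rewrite gaB; apply: gamma_funE.
exact: (extends_cov_pseudo uH c1 gc gaB).
Qed.

End Gamma.

Theorem mainTheorem8 (C : bivCategory) (hC : stackable C) (F H : bivariant C)
    (oneF : cov F pt) (oneH : cov H pt)
    (honeF : is_unit_pt oneF) (honeH : is_unit_pt oneH)
    (c : covTransformation F H)
    (cX : commutes_extprod c) (c1 : c pt oneF = oneH) :
  exists! gamma : grothendieck (Ftilde c hC) (Htilde c hC),
    forall (X : C) (a : cov F X),
      gamma X pt (to_pt X) (Ftilde_pt hC cX a) = Htilde_pt hC cX (to_Imc c a).
Proof.
exists (gamma_tilde hC c); split; first exact: gamma_tilde_extends.
by move=> g; exact: (extends_cov_unique honeH c1).
Qed.
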